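(* Let $G''\subset G'\subset G$ be inclusions of graphs (each a subgraph of the next) such that $G\searrow^{d}G'$ and $G\searrow^{d}G''$. Then $G'\searrow^{d}G''$.
   Context: Graphs are finite, undirected, without parallel edges; loops are allowed. $N_G(x)=\{y\in V(G): y\sim x\}$ is the open neighborhood (so $x\in N_G(x)$ iff $x$ is looped). A vertex $x$ of $G$ is dismantlable if there is another vertex $a\neq x$ of $G$ with $N_G(x)\subset N_G(a)$. $G\searrow^{d}H$ ($G$ is dismantlable on the subgraph $H$) means: $H$ is the subgraph of $G$ induced by $V(H)$ and one can write $V(G)\setminus V(H)=\{x_1,\dots,x_k\}$ ($k\ge 0$, distinct $x_i$) so that, for each $i$, $x_i$ is dismantlable in the subgraph of $G$ induced by $V(H)\cup\{x_i,x_{i+1},\dots,x_k\}$. *)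

(* Defs.v *)
From mathcomp Require Import all_boot.

Set Implicit Arguments.
Unset Strict Implicit.
Unset Printing Implicit Defensive.

(* Graphs whose vertices live in a common finite type [T]; a graph and its
   subgraphs share [T], and [vset] may be any (possibly empty) subset of it.
   [adj] is not assumed irreflexive: [adj x x] is a loop at [x]. *)
Record graph (T : finType) : Type := Graph {
  vset : {set T};
  adj : rel T;
  adj_sym : symmetric adj;
  adj_vset : forall x y : T, adj x y -> x \in vset
}.

Section GraphDefs.

Variable T : finType.
Implicit Types (G H : graph T) (A : {set T}) (x y : T).

Definition subgraph H G : Prop :=
  vset H \subset vset G /\ (forall x y, adj H x y -> adj G x y).

(* Equality of graphs, not comparing the proof fields of the record. *)
Definition eq_graph G H : Prop := vset G = vset H /\ adj G =2 adj H.

Definition induced_adj G A : rel T :=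
  fun x y => [&& x \in A, y \in A & adj G x y].

Lemma induced_adj_sym G A : symmetric (induced_adj G A).
Proof. by move=> x y; rewrite /induced_adj (adj_sym G x y) andbCA. Qed.

Lemma induced_adj_vset G A x y : induced_adj G A x y -> x \in A :&: vset G.
Proof. by case/and3P=> xA _ /adj_vset xG; rewrite inE xA. Qed.

Definition induced G A : graph T :=
  Graph (@induced_adj_sym G A) (@induced_adj_vset G A).

Definition nbhd G x : {set T} := [set y in vset G | adj G y x].

Definition dismantlable_vertex G x : Prop :=
  x \in vset G /\
  exists a : T, [/\ a \in vset G, a != x & nbhd G x \subset nbhd G a].

Definition dismantlable_on G H : Prop :=
  eq_graph H (induced G (vset H)) /\
  exists (k : nat) (x : 'I_k -> T),
    [/\ injective x,
        vset G :\: vset H = [set x i | i : 'I_k] &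
        forall i : 'I_k,
          dismantlable_vertex
            (induced G (vset H :|: [set x j | j : 'I_k & i <= j])) (x i)].

End GraphDefs.

(* Main.v *)
Require Import Defs.
From mathcomp Require Import all_boot all_fingroup.

Set Implicit Arguments.
Unset Strict Implicit.
Unset Printing Implicit Defensive.

(** [G'] and [G''] are induced subgraphs of [G], so everything happens between
    vertex sets [C \subset B \subset A] of one graph.  The theorem
    reduces to an exchange property, [dismantles_setD1]: if [A] dismantles
    onto [C] and some [x] outside [C] is dominated in [A], then [A :\ x] still
    dismantles onto [C].  Applying it along a dismantling of [A] onto [B], one
    deleted vertex at a time, turns the dismantling of [A] onto [C] into one
    of [B] onto [C].

    For the exchange property, let [y] be the first vertex deleted on the way
    from [A] to [C].  If [y <> x], inclusion of neighborhoods is transitive, so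
    deleting one of [x] and [y] leaves the other dominated, unless [x] and [y]
    dominate each other ([dominated_setD1]).  If both stay dominated, the two
    deletions commute and one concludes by induction.  Otherwise [x] and [y] have the
    same neighborhood in [A]; exchanging them is then an automorphism of [A]
    which fixes [C] pointwise and carries [A :\ y] to [A :\ x], and it
    transports the rest of the dismantling ([dismantles_twin]). *)

(** * Dismantling vertex sets *)

Section Dismantling.

Variable T : finType.
Implicit Types (e : rel T) (A B C : {set T}) (x y : T).

Definition dominates e A x a := forall z, z \in A -> e z x -> e z a.

Definition dominated e A x : Prop :=
  exists a, [/\ a \in A, a != x & dominates e A x a].

(** Deletions one at a time, in place of an indexed family of vertices, give
    the induction that the exchange argument runs on. *)
Inductive dismantles e C : {set T} -> Prop :=
| DismantlesRefl : dismantles e C C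
| DismantlesStep A x of x \in A & x \notin C & dominated e A x
    & dismantles e C (A :\ x) : dismantles e C A.

Lemma dismantles_sub e C A : dismantles e C A -> C \subset A.
Proof.
elim=> // {}A x _ _ _ _ sCA.
exact: subset_trans sCA (subD1set _ _).
Qed.

(** Used with a nontrivial bijection for the exchange of twins, and with the
    identity to replace the adjacency of a graph by that of a subgraph. *)
Lemma dismantles_imset e e' (p : T -> T) C A :
    injective p -> {in A &, forall u v, e' (p u) (p v) = e u v} ->
  dismantles e C A -> dismantles e' (p @: C) (p @: A).
Proof.
move=> p_inj pe dA; elim: dA pe => {A} [|A x xA xC [a [aA ax xa]] _ IH] pe.
  exact: DismantlesRefl.
apply: (@DismantlesStep _ _ _ (p x)); rewrite ?mem_imset //.
  exists (p a); split; rewrite ?mem_imset ?(inj_eq p_inj) //.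
  by move=> _ /imsetP[z zA ->]; rewrite !pe //; apply: xa.
have -> : p @: A :\ p x = p @: (A :\ x).
  apply/setP=> z; rewrite !inE; apply/andP/imsetP.
    case=> zpx /imsetP[w wA zw]; exists w => //; rewrite !inE wA andbT.
    by apply: contraNneq zpx => <-; rewrite zw.
  case=> w /setD1P[wx wA] ->; split; first by rewrite (inj_eq p_inj).
  exact: imset_f.
by apply: IH => u v /setD1P[_ uA] /setD1P[_ vA]; apply: pe.
Qed.

(** A dominating vertex other than [y] survives the deletion of [y]; if [x] is
    dominated by [y], any [b] that dominates [y] takes over, except [x]
    itself. *)
Lemma dominated_setD1 e A x y :
    dominated e A x -> dominated e A y ->
  dominated e (A :\ y) x \/ dominates e A x y /\ dominates e A y x.
Proof.
move=> [a [aA ax xa]] [b [bA b_y yb]].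
have [ay|a_y] := eqVneq a y; last first.
  left; exists a; split=> //; first by rewrite !inE a_y.
  by move=> z /setD1P[_ zA]; apply: xa.
rewrite {}ay in aA ax xa.
have [bx|b_x] := eqVneq b x; first by right; split=> //; rewrite -bx.
left; exists b; split=> //; first by rewrite !inE b_y.
by move=> z /setD1P[_ zA] /(xa z zA); apply: yb.
Qed.

Lemma dismantles_twin e C A x y : symmetric e ->
    x \in A -> y \in A -> x \notin C -> y \notin C ->
    dominates e A x y -> dominates e A y x ->
  dismantles e C (A :\ y) -> dismantles e C (A :\ x).
Proof.
move=> e_sym xA yA xC yC xy yx dAy.
have twin z : z \in A -> e z x = e z y.
  by move=> zA; apply/idP/idP; [apply: xy | apply: yx].
have twinl z : z \in A -> e x z = e y z.
  by move=> zA; rewrite e_sym twin // e_sym.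
have tA z : z \in A -> tperm x y z \in A by case: tpermP.
have te z w : z \in A -> w \in A -> e z (tperm x y w) = e z w.
  by move=> zA wA; case: tpermP => [->|->|//]; rewrite twin.
have tel z w : z \in A -> w \in A -> e (tperm x y z) w = e z w.
  by move=> zA wA; case: tpermP => [->|->|//]; rewrite twinl.
have -> : C = tperm x y @: C.
  rewrite -[LHS]imset_id; apply: eq_in_imset => z zC.
  by rewrite tpermD //; [apply: contraNneq xC | apply: contraNneq yC] => ->.
have -> : A :\ x = tperm x y @: (A :\ y).
  apply/setP=> z; rewrite -[z in RHS](tpermK x y) mem_imset; last exact: perm_inj.
  by rewrite !inE; case: tpermP => [->|->|/eqP-> /eqP->//];
     rewrite ?eqxx ?xA ?yA ?andbT // eq_sym.
apply: dismantles_imset dAy; first exact: perm_inj.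
by move=> u v /setD1P[_ uA] /setD1P[_ vA]; rewrite te ?tel ?tA.
Qed.

Lemma dismantles_setD1 e C A x : symmetric e ->
    x \in A -> x \notin C -> dominated e A x ->
  dismantles e C A -> dismantles e C (A :\ x).
Proof.
move=> e_sym + + + dA; elim: dA x => {A} [x -> // | A y yA yC domy dAy IH x].
move=> xA xC domx.
have [->//|xy] := eqVneq x y.
have [domxy|[xley ylex]] := dominated_setD1 domx domy; last first.
  exact: dismantles_twin dAy.
have [domyx|[ylex xley]] := dominated_setD1 domy domx; last first.
  exact: dismantles_twin dAy.
apply: (DismantlesStep _ yC domyx); first by rewrite !inE eq_sym xy.
have -> : A :\ x :\ y = A :\ y :\ x by rewrite !setDDl setUC.
by apply: IH; rewrite // !inE xy.
Qed.

Lemma dismantles_between e A B C : symmetric e -> C \subset B ->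
  dismantles e B A -> dismantles e C A -> dismantles e C B.
Proof.
move=> e_sym sCB; elim=> // {}A x xA xB domx _ IH dA; apply: IH.
by apply: dismantles_setD1 dA => //; apply: contra xB; apply: (subsetP sCB).
Qed.

End Dismantling.

(** * Dismantling graphs *)

Section Graphs.

Variable T : finType.
Implicit Types (G H : graph T) (A B : {set T}).

Lemma dismantlable_vertex_induced G A x : A \subset vset G ->
  dismantlable_vertex (induced G A) x <-> x \in A /\ dominated (adj G) A x.
Proof.
move=> /setIidPl sAG; rewrite /dismantlable_vertex /nbhd /= sAG.
split=> -[xA [a [aA ax xa]]]; split=> //; exists a; split=> //.
  move=> z zA zx; have /(subsetP xa): z \in [set y in A | induced_adj G A y x].
    by rewrite inE /induced_adj zA xA zx.
  by rewrite inE => /andP[_ /and3P[]].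
apply/subsetP=> z; rewrite !inE => /andP[zA /and3P[_ _ zx]].
by rewrite /induced_adj zA aA xa.
Qed.

Lemma imset_leq0 k (x : 'I_k -> T) :
  [set x j | j : 'I_k & 0 <= j] = [set x j | j : 'I_k].
Proof.
by apply/setP=> z; apply/imsetP/imsetP=> -[j _ ->]; exists j; rewrite ?inE.
Qed.

(** The set left after deleting the first [m] vertices of an enumeration is
    treated by induction on the number [k - m] of those still to delete. *)
Lemma dismantles_of_enum G B k (x : 'I_k -> T) :
    B \subset vset G -> injective x -> vset G :\: B = [set x i | i : 'I_k] ->
    (forall i : 'I_k, dismantlable_vertex
       (induced G (B :|: [set x j | j : 'I_k & i <= j])) (x i)) ->
  dismantles (adj G) B (vset G).
Proof.
move=> sBG x_inj Gx domx.
have xGB i : (x i \in vset G) && (x i \notin B).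
  have : x i \in [set x j | j : 'I_k] by apply: imset_f.
  by rewrite -Gx inE andbC.
pose R m := B :|: [set x j | j : 'I_k & m <= j].
have sRG m : R m \subset vset G.
  rewrite subUset sBG; apply/subsetP=> _ /imsetP[j _ ->].
  by have /andP[] := xGB j.
have dR n m : m + n = k -> dismantles (adj G) B (R m).
  elim: n m => [|n IH] m mk.
    rewrite addn0 in mk; suff -> : R m = B by exact: DismantlesRefl.
    rewrite /R mk; apply/setUidPl/subsetP=> _ /imsetP[j + ->].
    by rewrite inE leqNgt ltn_ord.
  have ltmk : m < k by rewrite -mk -addSnnS leq_addr.
  pose i := Ordinal ltmk; have /andP[_ xiB] := xGB i.
  have /(dismantlable_vertex_induced _ (sRG m))[xiR domi] := domx i.
  apply: (DismantlesStep xiR xiB domi).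
  suff -> : R m :\ x i = R m.+1 by apply: IH; rewrite addSnnS.
  apply/setP=> z; rewrite !inE.
  have [->|zxi] /= := eqVneq z (x i).
    rewrite (negPf xiB); apply/esym/imsetP=> -[j].
    by rewrite inE => ltmj /x_inj ij; rewrite -ij ltnn in ltmj.
  congr (_ || _); apply/imsetP/imsetP=> -[j]; rewrite inE => mj zj; exists j => //.
    rewrite inE ltn_neqAle mj andbT; apply: contra zxi => /eqP mj'.
    by rewrite zj; apply/eqP; congr (x _); apply/val_inj.
  by rewrite inE ltnW.
suff -> : vset G = R 0 by exact: (dR k).
by rewrite /R imset_leq0 -Gx -[LHS](setID _ B) (setIidPr sBG).
Qed.

Lemma enum_of_dismantles e A B : dismantles e B A ->
  exists k (x : 'I_k -> T),
    [/\ injective x, A :\: B = [set x i | i : 'I_k] &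
        forall i : 'I_k, dominated e (B :|: [set x j | j : 'I_k & i <= j]) (x i)].
Proof.
move=> dA; have := dismantles_sub dA.
elim: dA => {A} [|A y yA yB domy dAy IH] sBA.
  exists 0, (fun i : 'I_0 => match notF (ltn_ord i) with end).
  by split=> [[]//||[]//]; rewrite setDv; apply/esym/setP=> z; rewrite inE;
     apply/imsetP=> -[[]].
have [k [x [x_inj Ax domx]]] := IH (dismantles_sub dAy).
have xA i : [/\ x i != y, x i \in A & x i \notin B].
  have : x i \in [set x j | j : 'I_k] by apply: imset_f.
  by rewrite -Ax !inE => /and3P[].
pose x' (i : 'I_k.+1) := if unlift ord0 i is Some j then x j else y.
have x'0 : x' ord0 = y by rewrite /x' unlift_none.
have x'S i : x' (lift ord0 i) = x i by rewrite /x' liftK.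
have imx' (P : pred nat) z : (z \in [set x' j | j : 'I_k.+1 & P j]) =
    P 0 && (z == y) || (z \in [set x j | j : 'I_k & P j.+1]).
  apply/imsetP/orP=> [[i]|[/andP[P0 /eqP->]|/imsetP[i]]]; rewrite ?inE.
  - case: (unliftP ord0 i) => [j ->|->] Pi ->.
      by right; rewrite x'S; apply: imset_f; rewrite inE.
    by left; rewrite x'0 eqxx andbT.
  - by exists ord0; rewrite ?inE.
  - by move=> Pi ->; exists (lift ord0 i); rewrite ?inE.
have Ax' : A :\: B = [set x' i | i : 'I_k.+1].
  apply/setP=> z; rewrite -imset_leq0 (imx' (leq 0)) imset_leq0 -Ax !inE.
  by have [->|] := eqVneq z y; rewrite ?yA ?yB.
exists k.+1, x'; split=> // [i j|i].
  case: (unliftP ord0 i) (unliftP ord0 j) => [i' ->|->] [j' ->|->] //.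
  - by rewrite !x'S => /x_inj->.
  - by rewrite x'S x'0 => xy; have [] := xA i'; rewrite xy eqxx.
  - by rewrite x'S x'0 => yx; have [] := xA j'; rewrite -yx eqxx.
case: (unliftP ord0 i) => [j ->|->].
  rewrite x'S; suff -> : [set x' l | l : 'I_k.+1 & lift ord0 j <= l]
                       = [set x l | l : 'I_k & j <= l] by exact: domx.
  by apply/setP=> z; rewrite (imx' (leq (lift ord0 j))).
by rewrite x'0 imset_leq0 -Ax' -[X in X :|: _](setIidPr sBA) setID.
Qed.

Lemma dismantlable_onP G H :
  dismantlable_on G H <->
  eq_graph H (induced G (vset H)) /\ dismantles (adj G) (vset H) (vset G).
Proof.
split=> [[eqH [k [x [x_inj Gx domx]]]]|[eqH dG]]; split=> //.
  have sHG : vset H \subset vset G by case: eqH => /esym/setIidPl.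
  exact: dismantles_of_enum domx.
have sHG := dismantles_sub dG.
have [k [x [x_inj Gx domx]]] := enum_of_dismantles dG.
exists k, x; split=> // i; apply/dismantlable_vertex_induced.
  rewrite subUset sHG; apply/subsetP=> _ /imsetP[j _ ->].
  have : x j \in [set x l | l : 'I_k] by apply: imset_f.
  by rewrite -Gx inE => /andP[].
split; last exact: domx.
by rewrite inE; apply/orP; right; apply: imset_f; rewrite inE.
Qed.

End Graphs.

Theorem corollary2p1 (T : finType) (G G' G'' : graph T) :
  subgraph G'' G' -> subgraph G' G ->
  dismantlable_on G G' -> dismantlable_on G G'' ->
  dismantlable_on G' G''.
Proof.
move=> [sV _] _ /dismantlable_onP[[_ adj'] dG'] /dismantlable_onP[[_ adj''] dG''].
have adjG' : {in vset G' &, forall u v, adj G' u v = adj G u v}.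
  by move=> u v uG vG; rewrite adj' /= /induced_adj uG vG.
apply/dismantlable_onP; split.
  split=> [|u v]; first by apply/esym/setIidPl.
  rewrite adj'' /= /induced_adj; apply: andb_id2l => uG; apply: andb_id2l => vG.
  by rewrite adjG' ?(subsetP sV).
have dG := dismantles_between (adj_sym G) sV dG' dG''.
by have := @dismantles_imset _ _ (adj G') id _ _ (@inj_id _) adjG' dG;
   rewrite !imset_id.
Qed.
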